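(* For every positive integer $k$, the graph $G_k$ (defined in the context) satisfies ${\rm diam}(G_k)\le 2k+6$ and $\chi_{\rho}(G_k)\ge 2k+9$.
   Context: All graphs are finite and simple; $d(u,v)$ denotes the shortest-path distance and ${\rm diam}$ the diameter. For a positive integer $i$, an $i$-packing in a graph $G$ is a set $W\subseteq V(G)$ such that any two distinct vertices of $W$ are at distance greater than $i$. The packing chromatic number $\chi_\rho(G)$ is the smallest integer $k$ such that $V(G)$ can be partitioned into sets $V_1,\dots,V_k$ with $V_i$ an $i$-packing for each $i$. The graph $H$ has 15 vertices $y_1,\dots,y_7,z_1,\dots,z_7,w$ and edges $y_1y_5, y_5y_6, y_6y_7, y_7y_3, y_3y_2, y_2y_1, y_2y_4, y_4y_6$, the analogous edges $z_1z_5, z_5z_6, z_6z_7, z_7z_3, z_3z_2, z_2z_1, z_2z_4, z_4z_6$, and the edges $y_4w, wz_4, y_3z_1, y_5z_7$. The graph $G_0$ is obtained from two disjoint copies $H^{(1)}, H^{(2)}$ of $H$ (the vertex of $H^{(j)}$ corresponding to $v\in V(H)$ is written $v^{(j)}$) by adding five new vertices $a,b,c,d,x$ and the edges: $a$ adjacent to $y_1^{(1)}$ and $y_1^{(2)}$; $b$ adjacent to $z_3^{(1)}$ and $z_3^{(2)}$; $c$ adjacent to $y_7^{(1)}$ and $z_5^{(2)}$; $d$ adjacent to $z_5^{(1)}$ and $y_7^{(2)}$; $x$ adjacent to $w^{(1)}$ and $w^{(2)}$. For a positive integer $k$, the graph $G_k$ is built as follows. Take five perfect binary trees $A,B,C,D,X$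 of depth $k$; the vertices of a tree $T\in\{A,B,C,D,X\}$ are $T(\beta)$ for all binary strings $\beta$ of length $0,1,\dots,k$ ($T()$ is the root), and for $|\beta|<k$ the vertex $T(\beta)$ is adjacent to its two children $T(0\beta)$ and $T(1\beta)$ (a bit is prepended on the left). For each binary string $\beta$ of length $k$ take a copy $G_0(\beta)$ of $G_0$ (copies pairwise disjoint), and identify the vertex $a$ of $G_0(\beta)$ with the leaf $A(\beta)$, $b$ with $B(\beta)$, $c$ with $C(\beta)$, $d$ with $D(\beta)$, and $x$ with $X(\beta)$. *)

(* Defs.v *)
From HB Require Import structures.
From mathcomp Require Import all_boot.

Set Implicit Arguments.
Unset Strict Implicit.
Unset Printing Implicit Defensive.

Record sgraph := SGraph {
  vertex :> finType;
  adj : rel vertex;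
  adj_sym : symmetric adj;
  adj_irr : irreflexive adj
}.

Arguments adj {s}.

Section Metric.
Variable G : sgraph.
Implicit Types (u v : G) (W : {set G}).

Definition walk u v (n : nat) : bool :=
  [exists p : n.-tuple G, path adj u p && (last u p == v)].

Lemma connect_walk u v : connect adj u v -> exists n, walk u v n.
Proof.
case/connectP=> p p_path ->; exists (size p).
by apply/existsP; exists (in_tuple p); rewrite /= p_path eqxx.
Qed.

(* [None] stands for infinity. *)
Definition dist u v : option nat :=
  match @idP (connect adj u v) with
  | ReflectT uv => Some (ex_minn (connect_walk uv))
  | ReflectF _ => None
  end.

Definition emax (m n : option nat) : option nat :=
  if (m, n) is (Some m', Some n') then Some (maxn m' n') else None.

Definition diam : option nat := \big[emax/Some 0]_(p : G * G) dist p.1 p.2.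

Definition dist_gt u v (i : nat) : bool :=
  if dist u v is Some n then i < n else true.

Definition packing (i : nat) W : bool :=
  [forall u in W, forall v in W, (u != v) ==> dist_gt u v i].

(* The part [W i] is the i.+1-packing, since 'I_k starts at 0. As usual for
   colourings, parts may be empty; the minimum [chi_rho] is the same without
   empty parts, because an i-packing is a j-packing for all j <= i. *)
Definition packing_partition (k : nat) (W : {ffun 'I_k -> {set G}}) : bool :=
  [&& \bigcup_i W i == [set: G],
      [forall i, forall j, (i != j) ==> [disjoint W i & W j]]
    & [forall i : 'I_k, packing i.+1 (W i)]].

Definition packing_colorable (k : nat) : bool :=
  [exists W : {ffun 'I_k -> {set G}}, packing_partition W].

Lemma packing_colorable_ex : exists k, packing_colorable k.
Proof.
exists #|G|; apply/existsP; exists [ffun i => [set enum_val i]].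
apply/and3P; split.
- apply/eqP/setP=> v; rewrite inE; apply/bigcupP.
  by exists (enum_rank v) => //; rewrite ffunE enum_rankK set11.
- apply/forallP=> i; apply/forallP=> j; apply/implyP=> ij.
  rewrite !ffunE disjoints1 inE; apply: contra ij => /eqP ij.
  by apply/eqP; apply: enum_val_inj.
- apply/forallP=> i; apply/forall_inP=> u; rewrite ffunE inE => /eqP ->.
  by apply/forall_inP=> v; rewrite inE => /eqP ->; rewrite eqxx.
Qed.

Definition chi_rho : nat := ex_minn packing_colorable_ex.

End Metric.

Definition of_edges (V : eqType) (E : seq (V * V)) : rel V :=
  [rel u v | ((u, v) \in E) || ((v, u) \in E)].

Inductive Hvert :=
  | y1 | y2 | y3 | y4 | y5 | y6 | y7
  | z1 | z2 | z3 | z4 | z5 | z6 | z7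
  | w.

Definition Hvert_list : seq Hvert :=
  [:: y1; y2; y3; y4; y5; y6; y7; z1; z2; z3; z4; z5; z6; z7; w].

Definition Hvert_code (v : Hvert) : nat :=
  match v with
  | y1 => 0 | y2 => 1 | y3 => 2 | y4 => 3 | y5 => 4 | y6 => 5 | y7 => 6
  | z1 => 7 | z2 => 8 | z3 => 9 | z4 => 10 | z5 => 11 | z6 => 12 | z7 => 13
  | w => 14
  end.

Lemma Hvert_codeK : cancel Hvert_code (nth w Hvert_list).
Proof. by case. Qed.

HB.instance Definition _ := Countable.copy Hvert (can_type Hvert_codeK).

Lemma Hvert_listP : Finite.axiom Hvert_list.
Proof. by case. Qed.

HB.instance Definition _ := isFinite.Build Hvert Hvert_listP.

Definition H_edges : seq (Hvert * Hvert) :=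
  [:: (y1, y5); (y5, y6); (y6, y7); (y7, y3); (y3, y2); (y2, y1);
      (y2, y4); (y4, y6);
      (z1, z5); (z5, z6); (z6, z7); (z7, z3); (z3, z2); (z2, z1);
      (z2, z4); (z4, z6);
      (y4, w); (w, z4); (y3, z1); (y5, z7)].

(* Indexes both the vertices a, b, c, d, x of G_0 and the trees A, B, C, D, X
   whose leaves they are identified with. *)
Inductive hub := ha | hb | hc | hd | hx.

Definition hub_list : seq hub := [:: ha; hb; hc; hd; hx].

Definition hub_code (h : hub) : nat :=
  match h with ha => 0 | hb => 1 | hc => 2 | hd => 3 | hx => 4 end.

Lemma hub_codeK : cancel hub_code (nth hx hub_list).
Proof. by case. Qed.

HB.instance Definition _ := Countable.copy hub (can_type hub_codeK).

Lemma hub_listP : Finite.axiom hub_list.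
Proof. by case. Qed.

HB.instance Definition _ := isFinite.Build hub hub_listP.

(* [inr (false, v)] is v^(1) and [inr (true, v)] is v^(2). *)
Definition G0vert : finType := (hub + bool * Hvert)%type.

Definition G0_edges : seq (G0vert * G0vert) :=
  let v1 (v : Hvert) : G0vert := inr (false, v) in
  let v2 (v : Hvert) : G0vert := inr (true, v) in
  let a : G0vert := inl ha in let b : G0vert := inl hb in
  let c : G0vert := inl hc in let d : G0vert := inl hd in
  let x : G0vert := inl hx in
  [seq (v1 e.1, v1 e.2) | e <- H_edges] ++
  [seq (v2 e.1, v2 e.2) | e <- H_edges] ++
  [:: (a, v1 y1); (a, v2 y1);
      (b, v1 z3); (b, v2 z3);
      (c, v1 y7); (c, v2 z5);
      (d, v1 z5); (d, v2 y7);
      (x, v1 w); (x, v2 w)].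

Definition G0_adj : rel G0vert := of_edges G0_edges.

Section Gk.
Variable k : nat.

(* [inl (T, s)] is the vertex T(s), of which the leaves (size s = k) are also
   the vertices a, b, c, d, x of the copies of G_0; [inr (s, v)] is the vertex
   v of G_0(s), for v not among a, b, c, d, x. *)
Definition Gvert : finType :=
  (hub * k.-bseq bool + k.-tuple bool * (bool * Hvert))%type.

Definition embed (s : k.-tuple bool) (v : G0vert) : Gvert :=
  match v with
  | inl h => inl (h, bseq_of_tuple s)
  | inr p => inr (s, p)
  end.

Definition child (s t : seq bool) : bool := [exists i : bool, t == i :: s].

Definition tree_adj : rel Gvert := fun u v =>
  match u, v with
  | inl (T, s), inl (T', t) => (T == T') && (child s t || child t s)
  | _, _ => false
  end.

Definition copy_adj : rel Gvert := fun u v =>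
  [exists s : k.-tuple bool, exists u0 : G0vert, exists v0 : G0vert,
    [&& G0_adj u0 v0, embed s u0 == u & embed s v0 == v]].

Definition G_adj : rel Gvert := fun u v => tree_adj u v || copy_adj u v.

Lemma G_adj_sym : symmetric G_adj.
Proof.
have copyS u v : copy_adj u v -> copy_adj v u.
  case/existsP=> s /existsP[u0 /existsP[v0 /and3P[uv eu ev]]].
  apply/existsP; exists s; apply/existsP; exists v0; apply/existsP; exists u0.
  by rewrite eu ev !andbT; move: uv; rewrite /G0_adj /of_edges /= orbC.
move=> u v; rewrite /G_adj; congr (_ || _); last by apply/idP/idP; apply: copyS.
by case: u v => [[T s]|[s p]] [[T' t]|[t q]] //=; rewrite eq_sym [child _ _ || _]orbC.
Qed.

Lemma embed_inj s : injective (embed s).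
Proof. by move=> [h|p] [h'|q] //= [->]. Qed.

Lemma G_adj_irr : irreflexive G_adj.
Proof.
have childF s : child s s = false.
  by apply/existsP=> -[i /eqP/(congr1 size)/eqP]; rewrite /= ltn_eqF.
move=> u; apply/negbTE; rewrite negb_or; apply/andP; split.
  by case: u => [[T s]|[s p]] //=; rewrite childF andbF.
apply/existsP=> -[s /existsP[u0 /existsP[v0 /and3P[uv /eqP eu /eqP ev]]]].
have e0 : u0 = v0 by apply: (@embed_inj s); rewrite eu ev.
by move: uv; rewrite e0; case: v0 {ev e0} => [[]|[[] []]].
Qed.

Definition G_ : sgraph := SGraph G_adj_sym G_adj_irr.

End Gk.

(* Main.v *)
(** Every two vertices of [G_0] are joined by a walk of length at most 6 through
    a hub. Replacing the hub by a detour through the root of its tree, or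
    descending from the deeper of two tree vertices to a leaf and crossing a
    copy of [G_0], gives diameter at most 2k+6 for [G_k].

    For the lower bound, fix a colouring and call a vertex excessive for m if
    its colour exceeds m, where the diameter of the graph is at most m+1. A
    finite search shows that 1-, 2- and 3-packings miss at least four vertices
    of [H], so [H] has four excessive vertices for m = 3. If a graph has four
    excessive vertices for m, then the colours m+1 and m+2 serve at most one of
    them each, so at least two have colours above m+2; a graph containing two
    disjoint copies thus has four excessive vertices for m+2. As [G_0] contains
    two copies of [H] and [G_(k+1)] two copies of [G_k], the graph [G_k] has
    four vertices coloured above 2k+5, and each of the colours 2k+6, 2k+7, 2k+8
    serves at most one. *)

Require Import Defs.
From mathcomp Require Import all_boot.

Set Implicit Arguments.
Unset Strict Implicit.
Unset Printing Implicit Defensive.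

(** * Walks of bounded length and colourings as functions *)

Section Within.
Variables (T : eqType) (e : rel T).

(** Walks instead of [dist]: such bounds add under concatenation and pass through homomorphisms,
    with no minimum to compute. *)
Definition within (n : nat) (u v : T) : Prop :=
  exists p, [/\ path e u p, last u p = v & size p <= n].

Lemma within0 u : within 0 u u.
Proof. by exists [::]. Qed.

Lemma within_edge u v : e u v -> within 1 u v.
Proof. by move=> uv; exists [:: v]; rewrite /= uv. Qed.

Lemma within_trans v m n u t : within m u v -> within n v t -> within (m + n) u t.
Proof.
move=> [p [up up_v pm]] [q [vq vq_t qn]]; exists (p ++ q).
by rewrite cat_path last_cat size_cat up_v up vq leq_add.
Qed.

Lemma within_leq n m u v : m <= n -> within m u v -> within n u v.
Proof. by move=> mn [p [? ? pm]]; exists p; split=> //; apply: leq_trans mn. Qed.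

Lemma within_sym n u v : symmetric e -> within n u v -> within n v u.
Proof.
move=> eS [p [up <- pn]]; exists (rev (belast u p)); split.
- by rewrite rev_path (eq_path (e' := e)) // => x y; rewrite eS.
- by case: p {up pn} => //= x p; rewrite rev_cons last_rcons.
- by rewrite size_rev size_belast.
Qed.

(* Two vertices of colour i are not joined by a walk of length at most i; in
   this form it is clear that colourings restrict along homomorphisms. *)
Definition packing_coloring (c : T -> nat) : Prop :=
  (forall v, 0 < c v) /\
  (forall u v, u != v -> c u = c v -> ~ within (c u) u v).

End Within.

Lemma within_hom (T T' : eqType) (e : rel T) (e' : rel T') (f : T -> T') n u v :
  {homo f : x y / e x y >-> e' x y} -> within e n u v -> within e' n (f u) (f v).
Proof.
move=> fE [p [up <- pn]]; exists (map f p); split.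
- exact: homo_path up.
- by rewrite last_map.
- by rewrite size_map.
Qed.

Lemma packing_coloring_comp (T T' : eqType) (e : rel T) (e' : rel T')
    (f : T -> T') (c : T' -> nat) :
  injective f -> {homo f : x y / e x y >-> e' x y} ->
  packing_coloring e' c -> packing_coloring e (c \o f).
Proof.
move=> fI fE [c0 cP]; split=> [v|u v uv cuv /(within_hom fE)]; first exact: c0.
by apply: cP => //; rewrite (inj_eq fI).
Qed.

(** * Distance, diameter and packing partitions *)

Section Metric.
Variable G : sgraph.
Implicit Types u v : G.

(* A plain [case: idP] would also generalize the occurrence of [connect adj u v]
   in the type of the proof passed to [connect_walk]. *)
Lemma dist_cases u v :
  (exists uv : connect adj u v, dist u v = Some (ex_minn (connect_walk uv)))
  \/ (~ connect adj u v /\ dist u v = None).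
Proof.
rewrite /dist.
refine (match @idP (connect adj u v) as r in reflect _ b return
  (exists uv, match r with ReflectT uv' => Some (ex_minn (connect_walk uv'))
                         | ReflectF _ => None end
              = Some (ex_minn (connect_walk uv)))
  \/ (~ connect adj u v /\ match r with ReflectT uv' =>
       Some (ex_minn (connect_walk uv')) | ReflectF _ => None end = None)
  with ReflectT uv => _ | ReflectF n => _ end).
  by left; exists uv.
by right.
Qed.

Lemma within_dist n u v :
  within adj n u v -> exists2 m, dist u v = Some m & m <= n.
Proof.
case=> p [up up_v pn]; have [[uv ->]|[[]]] := dist_cases u v; last first.
  by apply/connectP; exists p.
eexists; first by []; case: ex_minnP => m _ m_min.
apply: leq_trans pn; apply: m_min.
by apply/existsP; exists (in_tuple p); rewrite /= up up_v eqxx.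
Qed.

Lemma dist_within n u v : dist u v = Some n -> within adj n u v.
Proof.
have [[uv ->]|[_ ->//]] := dist_cases u v.
case=> <-; case: ex_minnP => m /existsP[p /andP[up /eqP up_v]] _.
by exists p; rewrite size_tuple.
Qed.

Lemma dist_gtP i u v : reflect (~ within adj i u v) (dist_gt u v i).
Proof.
rewrite /dist_gt; case uv: (dist u v) => [n|]; last first.
  by constructor=> /within_dist[m]; rewrite uv.
case: ltnP => [ni|ni]; constructor.
  by case/within_dist=> m; rewrite uv => -[<-]; rewrite leqNgt ni.
by apply; apply: within_leq ni (dist_within uv).
Qed.

Lemma within_diam d :
  (forall u v, within adj d u v) -> exists2 D, diam G = Some D & D <= d.
Proof.
move=> Gd; rewrite /diam.
apply: (big_ind (fun o => exists2 D, o = Some D & D <= d)) => [|x y|[u v] _].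
- by exists 0.
- by move=> [m -> md] [n -> nd]; exists (maxn m n); rewrite // geq_max md.
- exact: within_dist.
Qed.

Lemma packing_colorable_coloring k :
  packing_colorable G k ->
  exists2 c, packing_coloring (adj (s := G)) c & forall v, c v <= k.
Proof.
case/existsP=> W /and3P[/eqP Wcover _ /forallP Wpack].
have Wmem v : exists i, v \in W i.
  by have := in_setT v; rewrite -Wcover => /bigcupP[i _]; exists i.
pose col v := xchoose (Wmem v).
have colP v : v \in W (col v) by exact: (xchooseP (Wmem v)).
(* The part [W i] is an [i.+1]-packing, hence the shift. *)
exists (fun v => (col v).+1) => [|v]; last exact: ltn_ord.
split=> // u v uv [/val_inj cuv]; apply/dist_gtP.
have /forall_inP/(_ u (colP u))/forall_inP/(_ v) := Wpack (col u).
by rewrite uv; apply; rewrite cuv.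
Qed.

End Metric.

(** * Counting vertices of large colour *)

Section Excess.
Variables (T : finType) (e : rel T).

(** The colourings may use any number of colours, so the property can be applied to a restriction to
    a subgraph. *)
Definition four_above (m : nat) : Prop :=
  forall c, packing_coloring e c -> 3 < #|[set v | m < c v]|.

Lemma card_above m c :
  (forall u v, within e m.+1 u v) -> packing_coloring e c ->
  #|[set v | m < c v]| <= #|[set v | m.+1 < c v]|.+1.
Proof.
move=> em [c0 cP].
have -> : [set v | m < c v] = [set v | c v == m.+1] :|: [set v | m.+1 < c v].
  by apply/setP=> v; rewrite !inE leq_eqVlt eq_sym.
apply: leq_trans (leq_card_setU _ _) _; rewrite -[leqRHS]add1n leq_add2r.
apply/card_le1_eqP=> u v; rewrite !inE => /eqP cu /eqP cv.
by apply/eqP; apply: contraT => uv; case: (cP v u uv); rewrite cv.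
Qed.

End Excess.

(* In each copy of [T] at most two of the four vertices coloured above [m] have
   the colours [m.+1] and [m.+2]. *)
Lemma four_above_double (T T' : finType) (e : rel T) (e' : rel T') m
    (f : bool -> T -> T') :
  (forall b, {homo f b : x y / e x y >-> e' x y}) ->
  (forall b, injective (f b)) -> (forall u v, f false u != f true v) ->
  (forall u v, within e m.+1 u v) -> four_above e m -> four_above e' m.+2.
Proof.
move=> fE fI fD em eP c cP.
have two b : 1 < #|f b @: [set v | m.+2 < c (f b v)]|.
  rewrite card_imset //.
  have cfP := packing_coloring_comp (fI b) (fE b) cP.
  have e2 u v : within e m.+2 u v by apply: within_leq (em u v).
  have := leq_trans (eP _ cfP) (card_above em cfP); rewrite ltnS => three.
  exact: leq_trans three (card_above e2 cfP).
have D : [disjoint f false @: [set v | m.+2 < c (f false v)]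
          & f true @: [set v | m.+2 < c (f true v)]].
  apply/pred0P=> x; apply/negbTE/andP=> -[/imsetP[u _ ->] /imsetP[v _]].
  by apply/eqP.
apply: (@leq_trans #|f false @: [set v | m.+2 < c (f false v)]
          :|: f true @: [set v | m.+2 < c (f true v)]|).
  by rewrite cardsU disjoint_setI0 // cards0 subn0 (leq_add (two _) (two _)).
apply: subset_leq_card; rewrite subUset.
by apply/andP; split; apply/subsetP=> x /imsetP[v]; rewrite !inE => vm ->.
Qed.

(** * Finite computations in [H] and G_0 *)

Definition nbrs (V : eqType) (E : seq (V * V)) (u : V) : seq V :=
  [seq e.2 | e <- E & e.1 == u] ++ [seq e.1 | e <- E & e.2 == u].

Definition ball (V : eqType) (E : seq (V * V)) (n : nat) (u : V) : seq V :=
  iter n (fun s => undup (s ++ flatten [seq nbrs E v | v <- s])) [:: u].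

Lemma of_edges_sym (V : eqType) (E : seq (V * V)) : symmetric (of_edges E).
Proof. by move=> u v; rewrite /of_edges /= orbC. Qed.

Lemma ball_within (V : eqType) (E : seq (V * V)) n u v :
  v \in ball E n u -> within (of_edges E) n u v.
Proof.
elim: n v => [v|n IHn v]; first by rewrite inE => /eqP->; apply: within0.
rewrite /ball iterS mem_undup mem_cat => /orP[/IHn|]; first exact: within_leq.
case/flattenP=> _ /mapP[x /IHn ux ->] xv; rewrite -addn1.
apply: within_trans ux (within_edge _); rewrite /of_edges /=.
move: xv; rewrite mem_cat => /orP[] /mapP[[y z]];
  by rewrite mem_filter /= => /andP[/eqP <- yz] ->; rewrite yz ?orbT.
Qed.

(* Looks for a partial colouring by 1, 2, 3 that extends [done] to the vertices
   of [todo], leaves at most [m] of them uncoloured and never repeats a colour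
   [i] in a set [near i v]. The tests are conditionals because call-by-value
   evaluation of [&&] would explore the pruned branches. *)
Fixpoint colorable (V : eqType) (near : nat -> V -> seq V) (todo : seq V)
    (done : seq (V * nat)) (m : nat) : bool :=
  if todo is v :: todo' then
    has (fun i => if has (fun e => (e.2 == i) && (e.1 \in near i v)) done
                  then false else colorable near todo' ((v, i) :: done) m)
        [:: 1; 2; 3]
    || (if m is m'.+1 then colorable near todo' done m' else false)
  else true.

(** Following [c] gives a successful run of the search: a vertex of colour at most 3 takes that
    colour, without conflict since [near] lists only close vertices, and any other vertex spends one
    unit of [m]. *)
Lemma coloring_colorable (V : eqType) (e : rel V) (near : nat -> V -> seq V)
    (c : V -> nat) todo done m :
  symmetric e -> (forall i u v, u \in near i v -> within e i v u) ->
  packing_coloring e c -> uniq todo ->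
  (forall x, x \in done -> c x.1 = x.2 /\ x.1 \notin todo) ->
  count (fun v => 3 < c v) todo <= m -> colorable near todo done m.
Proof.
move=> eS nearP [c0 cP].
elim: todo done m => // v todo IH done m.
rewrite [uniq _]/= [count _ _]/= => /andP[v_todo todoU] doneP.
case: (ltnP 3 (c v)) => cv; last first.
  rewrite add0n => tm; apply/orP; left; apply/hasP; exists (c v).
    by move: (c0 v) cv; case: (c v) => [|[|[|[|]]]].
  case: hasP => [[[u i] /doneP[/= cu uv] /andP[/= /eqP ic u_near]]|_].
    move: uv; rewrite inE negb_or => /andP[uv _].
    by case: (cP v u); rewrite 1?eq_sym ?cu //; apply: nearP.
  apply: IH => // x; rewrite inE => /orP[/eqP->|/doneP[] //] //.
  by rewrite inE negb_or => -> /andP[].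
case: m => [|m]; rewrite ?add1n // ltnS => tm; apply/orP; right.
by apply: IH => // x /doneP[->]; rewrite inE negb_or => /andP[].
Qed.

(** Radii 0 to 4: the search looks up 1 to 3, the diameter bound 4. *)
Definition H_balls : seq (seq (seq Hvert)) :=
  [seq [seq ball H_edges i v | v <- Hvert_list] | i <- iota 0 5].

(* [H_balls] is looked up and not recomputed in the evaluations below. *)
Definition H_near (i : nat) (v : Hvert) : seq Hvert :=
  nth [::] (nth [::] H_balls i) (Hvert_code v).

Lemma H_near_within i u v :
  u \in H_near i v -> within (of_edges H_edges) i v u.
Proof.
rewrite /H_near /H_balls; case: (ltnP i 5) => i5; last first.
  (* Beyond radius 4 the table yields the empty list, so the membership hypothesis fails. *)
  by rewrite (nth_default [::] (s := map _ _)) ?nth_nil // size_map size_iota.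
rewrite (nth_map 0) ?size_iota // nth_iota // (nth_map w); last by case: v.
by rewrite Hvert_codeK; apply: ball_within.
Qed.

Lemma H_not_colorable : colorable H_near Hvert_list [::] 3 = false.
Proof. by vm_compute. Qed.

Lemma H_diam : all (fun u => all (mem (H_near 4 u)) Hvert_list) Hvert_list.
Proof. by vm_compute. Qed.

Lemma mem_Hvert_list v : v \in Hvert_list.
Proof. by case: v. Qed.

Lemma H_within u v : within (of_edges H_edges) 4 u v.
Proof.
apply: H_near_within; have /allP/(_ u (mem_Hvert_list u))/allP := H_diam.
by apply; apply: mem_Hvert_list.
Qed.

Lemma H_four_above : four_above (of_edges H_edges) 3.
Proof.
move=> c cP; rewrite ltnNge; apply/negP=> c3.
have := H_not_colorable; rewrite (coloring_colorable (c := c) _ _ cP) //.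
- exact: of_edges_sym.
- exact: H_near_within.
- rewrite -size_filter; apply: leq_trans c3; rewrite cardE.
  apply: uniq_leq_size => [|v]; first by rewrite filter_uniq.
  by rewrite mem_filter mem_enum => /andP[v3 _]; rewrite inE.
Qed.

Definition G0_vertices : seq G0vert :=
  [seq inl h | h <- hub_list] ++
  [seq inr (b, v) | b <- [:: false; true], v <- Hvert_list].

Definition hub_balls : seq (seq (seq G0vert)) :=
  [seq [seq ball G0_edges i (inl h) | i <- iota 0 7] | h <- hub_list].

Lemma G0_via_hub_balls :
  all (fun u => all (fun v => has (fun B => has (fun i =>
    (u \in nth [::] B i) && (v \in nth [::] B (6 - i))) (iota 0 7))
  hub_balls) G0_vertices) G0_vertices.
Proof. by vm_compute. Qed.

Lemma mem_G0_vertices v : v \in G0_vertices.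
Proof. by case: v => [[]|[[] []]]. Qed.

(** The walk is split at the hub so that its two parts can later be placed in different copies of
    G_0. *)
Lemma G0_via_hub u v : exists h i j,
  [/\ within (of_edges G0_edges) i u (inl h),
      within (of_edges G0_edges) j (inl h) v & i + j = 6].
Proof.
have /allP/(_ u (mem_G0_vertices u))/allP/(_ v (mem_G0_vertices v)) :=
  G0_via_hub_balls.
case/hasP=> _ /mapP[h _ ->] /hasP[i]; rewrite mem_iota add0n => i7.
have i6 : 6 - i < 7 by rewrite ltnS leq_subr.
rewrite !(nth_map 0) ?size_iota // !nth_iota // => /andP[/ball_within ui].
move=> /ball_within vi; exists h, i, (6 - i); split=> //.
  exact: within_sym (@of_edges_sym _ _) ui.
by rewrite subnKC.
Qed.

Lemma G0_within u v : within (of_edges G0_edges) 6 u v.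
Proof.
by have [h [i [j [uh hv <-]]]] := G0_via_hub u v; apply: within_trans uh hv.
Qed.

(** * Diameter of G_k *)

Section Diameter.
Variable k : nat.
Let e := @G_adj k.

Lemma embed_homo s : {homo @embed k s : u v / of_edges G0_edges u v >-> e u v}.
Proof.
move=> u v uv; apply/orP; right; apply/existsP; exists s.
by apply/existsP; exists u; apply/existsP; exists v; rewrite !eqxx !andbT.
Qed.

Lemma child_within h (s : k.-bseq bool) (i : bool) (is_k : size (i :: s) <= k) :
  within e 1 (inl (h, s)) (inl (h, Bseq is_k)).
Proof.
apply: within_edge; rewrite /e /G_adj /= eqxx /=; apply/orP; left.
by apply/orP; left; apply/existsP; exists i.
Qed.

Lemma root_within h (s : k.-bseq bool) :
  within e (size s) (inl (h, [bseq])) (inl (h, s)).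
Proof.
case: s => s /= sk; elim: s sk => [|i s IH] sk.
  by rewrite (_ : Bseq sk = [bseq]); [apply: within0 | apply: val_inj].
rewrite -[size _]/(size s).+1 -addn1; apply: within_trans (IH (ltnW sk)) _.
exact: (@child_within h (Bseq (ltnW sk)) i sk).
Qed.

Lemma leaf_within h (s : k.-bseq bool) :
  exists t : k.-tuple bool, within e (k - size s) (inl (h, s)) (embed t (inl h)).
Proof.
move: {2}(k - size s) (erefl (k - size s)) => n.
elim: n s => [|n IH] s sn.
  have sk : size s == k by rewrite eqn_leq size_bseq -subn_eq0 sn.
  exists (Tuple sk); rewrite sn /= (_ : bseq_of_tuple _ = s).
    exact: within0.
  exact: val_inj.
have sk : size (false :: s) <= k by rewrite /= -subn_gt0 sn.
have [|t st] := IH (Bseq sk); first by rewrite /= subnS sn.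
exists t; rewrite sn -add1n; apply: within_trans (child_within h sk) _.
by move: st; rewrite /= subnS sn.
Qed.

Let within_symG n u v : within e n u v -> within e n v u :=
  within_sym (@G_adj_sym k).

Lemma G_within u v : within e (2 * k + 6) u v.
Proof.
have leafK h (t : k.-tuple bool) : within e k (inl (h, [bseq])) (embed t (inl h)).
  by have := root_within h t; rewrite size_tuple.
have tree_copy h s t p : within e (2 * k + 6) (inl (h, s)) (inr (t, p)).
  apply: (@within_leq _ _ _ (size s + k + 6)).
    by rewrite leq_add2r mul2n -addnn leq_add2r size_bseq.
  apply: (@within_trans _ _ (embed t (inl h))); last first.
    exact: within_hom (@embed_homo t) (G0_within _ (inr p)).
  exact: within_trans (within_symG (root_within h s)) (leafK h t).
have tree_tree h h' (s s' : k.-bseq bool) : size s' <= size s ->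
    within e (2 * k + 6) (inl (h, s)) (inl (h', s')).
  move=> ss'; have [t st] := leaf_within h s.
  (* Down to a leaf, across a copy to the other tree, up to its root and down to the target;
     [size s' <= size s] bounds the total. *)
  apply: (@within_leq _ _ _ (k - size s + 6 + (k + size s'))).
    rewrite addnAC leq_add2r mul2n -addnn addnCA leq_add2l.
    by rewrite -[leqRHS](subnK (size_bseq s)) leq_add2l.
  apply: (@within_trans _ _ (embed t (inl h'))); last first.
    exact: within_trans (within_symG (leafK h' t)) (root_within h' s').
  apply: within_trans st _.
  exact: within_hom (@embed_homo t) (G0_within _ _).
case: u v => [[h s]|[t p]] [[h' s']|[t' p']].
- case: (leqP (size s') (size s)) => [|/ltnW] ss'; first exact: tree_tree.
  by apply: within_symG; apply: tree_tree.
- exact: tree_copy.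
- by apply: within_symG; apply: tree_copy.
(* The hub is chosen as if both vertices lay in one copy; the leaf-root-leaf detour adds [k + k]. *)
have [h [i [j [ph hp' <-]]]] := G0_via_hub (inr p) (inr p').
rewrite mul2n -addnn addnACA.
apply: (@within_trans _ _ (inl (h, [bseq]))); rewrite addnC.
  apply: within_trans (within_hom (@embed_homo t) ph) _.
  exact: within_symG (leafK h t).
rewrite addnC; apply: within_trans (leafK h t') _.
exact: within_hom (@embed_homo t') hp'.
Qed.

End Diameter.

(** * Lower bound by doubling *)

Section Halves.
Variables (k : nat) (b : bool).

(** Bits are prepended on the way down, so the last bit is the branch taken at the root: appending
    [b] lands below the root's child [b] in every tree. *)
Definition half (u : Gvert k) : Gvert k.+1 :=
  match u with
  | inl (h, s) => inl (h, rcons_bseq s b)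
  | inr (s, p) => inr (rcons_tuple s b, p)
  end.

Lemma half_inj : injective half.
Proof.
move=> [[h s]|[s p]] [[h' s']|[s' p']] //= [].
  by move=> -> /rcons_inj[/val_inj ->].
by move=> /rcons_inj[/val_inj ->] ->.
Qed.

Lemma half_homo : {homo half : u v / G_adj u v >-> G_adj u v}.
Proof.
have child_half s t : child s t -> child (rcons s b) (rcons t b).
  by case/existsP=> i /eqP ->; apply/existsP; exists i.
move=> u v; rewrite /G_adj => /orP[] uv; apply/orP; [left|right].
  move: u v uv => [[h s]|[s p]] [[h' s']|[s' p']] //= /andP[-> /=].
  by case/orP=> /child_half -> //; rewrite orbT.
case/existsP: uv => s /existsP[u0 /existsP[v0 /and3P[uv /eqP <- /eqP <-]]].
have half_embed p : half (embed s p) = embed (rcons_tuple s b) p.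
  by case: p => //= h; congr (inl (_, _)); apply: val_inj.
apply/existsP; exists (rcons_tuple s b); apply/existsP; exists u0.
by apply/existsP; exists v0; rewrite !half_embed !eqxx uv.
Qed.

End Halves.

Lemma G_four_above k : four_above (@G_adj k) (2 * k + 5).
Proof.
elim: k => [|k IH].
  have HG0 b u v : (u, v) \in H_edges ->
      ((inr (b, u), inr (b, v)) : G0vert * G0vert) \in G0_edges.
    move/(map_f (fun x => (inr (b, x.1), inr (b, x.2)) : G0vert * G0vert)).
    by rewrite /G0_edges !mem_cat; case: b => -> //; rewrite orbT.
  (* For [k = 0] the empty string indexes the only copy of G_0, and [b] selects one of its two
     copies of [H]. *)
  pose f b v : Gvert 0 := embed [tuple] (inr (b, v)).
  apply: (four_above_double (f := f) _ _ _ H_within H_four_above) => //.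
  - move=> b u v uv; apply: embed_homo; move: uv.
    by case/orP=> /HG0 uv; apply/orP; [left|right].
  - by move=> b u v [].
rewrite mulnS addSn addSn addSn.
apply: (four_above_double (f := @half k) _ _ _ _ IH).
- exact: half_homo.
- exact: half_inj.
- move=> [[h s]|[s p]] [[h' s']|[s' p']] //=; apply/eqP=> -[].
    by move=> _ /rcons_inj[].
  by move=> /rcons_inj[].
- move=> u v; have := G_within u v; by rewrite -addnS.
Qed.

Theorem theorem6 (k : nat) (hk : 0 < k) :
  (exists2 D : nat, diam (G_ k) = Some D & D <= 2 * k + 6) /\
  2 * k + 9 <= chi_rho (G_ k).
Proof.
split; first by apply: within_diam => u v; apply: G_within.
rewrite /chi_rho; case: ex_minnP => m m_col _; rewrite leqNgt; apply/negP=> mk.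
have [c cP cm] := packing_colorable_coloring m_col.
(* Colour [i.+1] is at least the diameter, so it occurs at most once. *)
have drop i : 2 * k + 5 <= i -> #|[set v | i < c v]| <= #|[set v | i.+1 < c v]|.+1.
  move=> ki; apply: card_above cP => u v.
  by apply: within_leq (G_within u v); rewrite addnS ltnS.
(* By [mk] all colours are at most 2k+8, which is [(2 * k + 5).+3]. *)
have top : #|[set v | (2 * k + 5).+3 < c v]| = 0.
  apply: eq_card0 => v; rewrite inE; apply/negbTE; rewrite -leqNgt.
  by apply: leq_trans (cm v) _; rewrite -ltnS -!addnS.
have := G_four_above cP; rewrite ltnNge => /negP; apply.
apply: leq_trans (drop _ _) _; rewrite ?ltnS //.
apply: leq_trans (drop _ _) _; rewrite ?ltnS //.
by apply: leq_trans (drop _ _) _; [do 2 apply: leqW | rewrite top].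
Qed.
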